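(* Let $X=(X,\phi)$ be a discrete semi-flow whose underlying topological space $X$ is a locally compact regular space. Then $\bar L(X^{\mathbf r})=\overline{\Lambda(X)}$.
   Context: $\mathbb{N}=\{0,1,2,\dots\}$. A discrete semi-flow on a topological space $X$ is a continuous map $\phi\colon\mathbb{N}\times X\to X$ ($\mathbb{N}$ discrete) with $\phi(0,x)=x$ and $\phi(n,\phi(m,x))=\phi(n+m,x)$; write $\phi^n(x)=n\cdot x=\phi(n,x)$. The omega-limit set of $x$ is $\Lambda(x)=\bigcap_{n\ge 0}\overline{\{m\cdot x\mid m\ge n\}}$, and $\Lambda(X)=\bigcup_{x\in X}\Lambda(x)$. The right-absorbing externology $\varepsilon^{\mathbf r}(X)$ is the family of all open $E\subset X$ such that for every $x\in X$ there is $n\in\mathbb{N}$ with $\phi^m(x)\in E$ for all $m\ge n$. $X^{\mathbf r}$ denotes $(X,\phi,\varepsilon^{\mathbf r}(X))$, and its bar-limit space is $\bar L(X^{\mathbf r})=\bigcap_{E\in\varepsilon^{\mathbf r}(X)}\overline{E}$. Regular means that a point and a closed set not containing it have disjoint open neighborhoods; locally compact means that every point has a compact neighborhood. *)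

(* Defs.v *)
From mathcomp Require Import all_boot all_order all_algebra.
From mathcomp Require Import all_classical topology.

Set Implicit Arguments.
Unset Strict Implicit.
Unset Printing Implicit Defensive.

Local Open Scope classical_set_scope.

(* Continuity is joint, for the product topology on nat * X; the library's
   topology on nat is the discrete one. *)
Record semiflow (X : topologicalType) := Semiflow {
  flow :> nat -> X -> X ;
  flow_continuous : continuous (fun p : nat * X => flow p.1 p.2) ;
  flow0 : forall x, flow 0%N x = x ;
  flowD : forall n m x, flow n (flow m x) = flow (n + m)%N x
}.

Definition omega_limit (X : topologicalType) (phi : semiflow X) (x : X)
    : set X :=
  \bigcap_(n in [set: nat]) closure [set phi m x | m in [set m | (n <= m)%N]].

Definition omega_limits (X : topologicalType) (phi : semiflow X) : set X :=
  \bigcup_(x in [set: X]) omega_limit phi x.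

Definition right_externology (X : topologicalType) (phi : semiflow X)
    : set (set X) :=
  [set E | open E /\
     forall x, exists n : nat, forall m : nat, (n <= m)%N -> E (phi m x)].

Definition bar_limit (X : topologicalType) (eps : set (set X)) : set X :=
  \bigcap_(E in eps) closure E.

(* The library's [locally_compact [set: X]] asks for a compact neighborhood
   that is moreover closed, which is a stronger condition in the absence of
   separation axioms. *)
Definition locally_compact_space (X : topologicalType) :=
  forall x : X, exists2 K : set X, nbhs x K & compact K.

(* Main.v *)
Require Import Defs.
From mathcomp Require Import all_boot all_order all_algebra.
From mathcomp Require Import all_classical topology.

(** Both inclusions compare absorbing open sets with tails of orbits.  An
    absorbing set contains a tail of each orbit, so its closure contains every
    omega-limit set, and, being closed, also the closure of their union.
    Conversely, suppose that [p] is outside this closure.  By local compactness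
    and regularity, [p] has a closed compact neighborhood [C] disjoint from all
    omega-limit sets.  By compactness an orbit that returned to [C] infinitely
    often would have an omega-limit point in [C]
    ([compact_eventually_avoided]); so every orbit finally leaves [C].  Hence
    the complement of [C] is an absorbing open set, and its closure misses
    [p]. *)

Local Open Scope classical_set_scope.

(** A compact set need not be closed here, so the complement of a compact
    neighborhood may fail to be open.  Regularity repairs this: it gives a
    closed neighborhood inside the compact one. *)
Lemma compact_closed_nbhs (X : topologicalType) (lcX : locally_compact_space X)
    (regX : regular_space X) (p : X) (U : set X) :
  nbhs p U -> exists C, [/\ nbhs p C, closed C, compact C & C `<=` U].
Proof.
move=> pU; have [K pK cK] := lcX p.
have [V pV VUK] := regX p (U `&` K) (filterI pU pK).
exists (closure V); split.
- exact: filterS (@subset_closure _ V) pV.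
- exact: closed_closure.
- apply: subclosed_compact (@closed_closure _ V) cK _.
  by move=> y /VUK[].
- by move=> y /VUK[].
Qed.

(** The tails of the orbit of [x] traced on [C] generate the image filter used
    below.  If the orbit met [C] infinitely often, this filter would be proper,
    and compactness would give it a cluster point in [C]; such a point lies in
    the closure of each tail. *)
Lemma compact_eventually_avoided (X : topologicalType) (phi : semiflow X)
    (x : X) (C : set X) :
  compact C -> C `&` omega_limit phi x = set0 ->
  \forall m \near \oo, ~ C (phi m x).
Proof.
move=> cC CL0; apply: contrapT => often.
pose F := phi ^~ x @ within [set m | C (phi m x)] \oo.
have FF : ProperFilter F by split; [exact: often|exact: fmap_filter].
have FC : F C by exact: nearW.
have [q [Cq Fq]] := cC F FF FC.
suff : set0 q by [].
rewrite -CL0; split=> // n _ B qB.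
apply: Fq qB.
by exists n => // m nm _; exists m.
Qed.

Lemma omega_limit_sub_closure (X : topologicalType) (phi : semiflow X) (x : X)
    (E : set X) :
  right_externology phi E -> omega_limit phi x `<=` closure E.
Proof.
move=> [_ /(_ x)[n nE]] q /(_ n I); apply: closure_subset.
by move=> _ [m nm <-]; exact: nE.
Qed.

(* [regular_space] is the separation of points from closed sets by disjoint
   open sets: see [regular_openP] in [normedtype_theory/urysohn.v]. *)
Theorem theorem7p2 (X : topologicalType) (phi : semiflow X)
    (lcX : locally_compact_space X) (regX : regular_space X) :
  bar_limit (right_externology phi) = closure (omega_limits phi).
Proof.
apply/seteqP; split=> p; last first.
  move=> pL E phiE; move: p pL; rewrite -/(_ `<=` _).
  rewrite [X in _ `<=` X](closure_id _).1; last exact: closed_closure.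
  by apply: closure_subset => q [x _]; exact: omega_limit_sub_closure.
apply: contraPP => pL pbar.
have [C [pC clC cC CL]] : exists C, [/\ nbhs p C, closed C, compact C
    & C `<=` ~` closure (omega_limits phi)].
  apply: compact_closed_nbhs => //.
  by apply: open_nbhs_nbhs; split=> //; exact/closed_openC/closed_closure.
have absC : right_externology phi (~` C).
  split=> [|x]; first exact: closed_openC.
  have [|n _ nC] := @compact_eventually_avoided _ phi x C cC _.
    apply/seteqP; split=> // q [/CL Lq xq].
    by apply: Lq; apply: subset_closure; exists x.
  by exists n => m; exact: nC.
by have [q []] := pbar _ absC C pC.
Qed.
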